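(* Let $\mathbb{K}$ be a field, let $U$ and $V$ be finite-dimensional vector spaces over $\mathbb{K}$, and let $S$ be a linear subspace of $\mathcal{L}(U,V)$. Assume that $\operatorname{codim} S \leq \dim V-2$, and that $\operatorname{codim} S \leq \dim V-3$ if $\# \mathbb{K}=2$. Then, every quasi-range-compatible homomorphism $F : S \rightarrow V$ is local.
   Context: $\mathcal{L}(U,V)$ is the vector space of all linear maps from $U$ to $V$, and $\operatorname{codim} S=\dim \mathcal{L}(U,V)-\dim S$. ''Homomorphism'' means homomorphism of additive groups (not necessarily $\mathbb{K}$-linear). For a subset $S$ of $\mathcal{L}(U,V)$ and a $1$-dimensional linear subspace $D$ of $V$, a map $F : S \rightarrow V$ is quasi-range-compatible with respect to $D$ when, for all $s \in S$, $D \not\subset \operatorname{Im} s$ implies $F(s) \in \operatorname{Im} s$. It is quasi-range-compatible when it is quasi-range-compatible with respect to some $1$-dimensional linear subspace of $V$. It is local when there exists $x \in U$ such that $F(s)=s(x)$ for all $s \in S$. *)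

(* Defs.v *)
From HB Require Import structures.
From mathcomp Require Import all_boot all_order all_algebra.

Set Implicit Arguments.
Unset Strict Implicit.
Unset Printing Implicit Defensive.

Import GRing.Theory.
Local Open Scope ring_scope.

(* K need not be finite, so #|K| is not available. *)
Definition has_card (n : nat) (T : Type) : Prop :=
  exists f : 'I_n -> T, bijective f.

Section RangeCompatible.

Variables (K : fieldType) (U V : vectType K).
Implicit Types (S : {vspace 'Hom(U, V)}) (D : {vspace V}).

(* The truncated subtraction is harmless, as \dim S <= \dim {:'Hom(U, V)}. *)
Definition codim S : nat := (\dim {:'Hom(U, V)} - \dim S)%N.

Definition quasi_range_compatible_wrt S D (F : subvs_of S -> V) : Prop :=
  forall s : subvs_of S,
    ~~ (D <= limg (vsval s))%VS -> F s \in limg (vsval s).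

Definition quasi_range_compatible S (F : subvs_of S -> V) : Prop :=
  exists2 D : {vspace V}, \dim D = 1%N & quasi_range_compatible_wrt D F.

Definition local S (F : subvs_of S -> V) : Prop :=
  exists x : U, forall s : subvs_of S, F s = (vsval s) x.

End RangeCompatible.

(* Main.v *)
(* Fix e spanning D and work modulo subspaces Y of V that do not contain e: we show
   that F agrees modulo Y with evaluation at some vector, by induction on the
   codimension of M Y = S + L(U, Y), which is that of S modulo Y; the case Y = 0 is
   the theorem.  If M Y is everything, F splits modulo Y into additive maps
   h_i : V -> V, one per basis vector of U, with h_i v collinear to v modulo Y
   for every v outside Y + D; such maps are homotheties modulo Y.  Otherwise, there
   are two vectors y1, y2, independent modulo Y and outside Y + D, such that
   passing to Y + <y_j> decreases the codimension.  By induction F is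
   evaluation at x_j modulo Y + <y_j>; a dimension count forces x1 = x2, and the
   two subspaces Y + <y_j> meet in Y. *)
Require Import Defs.
From HB Require Import structures.
From mathcomp Require Import all_boot all_order all_algebra.
From mathcomp Require Import ring zify.

Set Implicit Arguments.
Unset Strict Implicit.
Unset Printing Implicit Defensive.

Import GRing.Theory.
Local Open Scope ring_scope.

(* The boolean conclusion avoids excluded middle: K may be infinite, so the
   existence of t is not decidable. *)
Lemma third_scalar (K : fieldType) (b : bool) :
    ~ has_card 2 K -> (forall t : K, t != 0 -> t != -1 -> b) -> b.
Proof.
move=> card_neq2 third; apply: contraT => /negP not_b; case: card_neq2.
have two (t : K) : t != 0 -> t = -1.
  by move=> t_neq0; apply/eqP/negPn/negP => /(third _ t_neq0).
exists (fun i => if i == ord0 then 0 else -1).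
exists (fun t : K => if t == 0 then ord0 else lift ord0 ord0).
  case=> [[|[|//]]] i_lt2 /=; apply: val_inj; rewrite /= ?eqxx //.
  by rewrite oppr_eq0 oner_eq0.
by move=> t /=; case: (eqVneq t 0) => [->//|/two ->].
Qed.

(** * Coordinates of vectors *)

Section Coordinates.

Variables (K : fieldType) (V : vectType K).
Import VectorInternalTheory.

Lemma v2rD_coord (v w : V) i : v2r (v + w) 0 i = v2r v 0 i + v2r w 0 i.
Proof. by rewrite linearD mxE. Qed.

Lemma v2rN_coord (v : V) i : v2r (- v) 0 i = - v2r v 0 i.
Proof. by rewrite linearN mxE. Qed.

Lemma v2rZ_coord a (v : V) i : v2r (a *: v) 0 i = a * v2r v 0 i.
Proof. by rewrite linearZ mxE. Qed.

Lemma v2r0_coord i : v2r (0 : V) 0 i = 0.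
Proof. by rewrite linear0 mxE. Qed.

Definition v2r_coordE := (v2rD_coord, v2rN_coord, v2rZ_coord, v2r0_coord).

End Coordinates.

(* Identities between vectors are checked coordinatewise, where [ring] applies. *)
Ltac vector_ring :=
  apply: (can_inj VectorInternalTheory.v2rK); apply/rowP => ?;
  rewrite ?v2r_coordE; ring.

(** * Subspaces and collinearity modulo a subspace *)

Section SubspaceFacts.

Variables (K : fieldType) (V : vectType K).
Implicit Types (E W Y Z : {vspace V}) (e v w y : V).

Lemma memv_add_lineP Y y v :
  reflect (exists k, v - k *: y \in Y) (v \in Y + <[y]>)%VS.
Proof.
apply: (iffP memv_addP) => [[y' y'Y [_ /vlineP[k ->] ->]]|[k vkY]].
  by exists k; rewrite addrK.
by exists (v - k *: y) => //; exists (k *: y); rewrite ?subrK ?memvZ ?memv_line.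
Qed.

Lemma dim_add_line Y y : (\dim (Y + <[y]>) <= \dim Y + 1)%N.
Proof.
apply: leq_trans (dimv_add_leqif _ _) _.
by rewrite leq_add2l dim_vline leq_b1.
Qed.

Lemma proper_exists_notin E : (\dim E < \dim {:V})%N -> exists v, v \notin E.
Proof.
move=> ltE; suff /subvPn[v _ vE] : ~~ ({:V} <= E)%VS by exists v.
by apply: contraL ltE => /dimvS; rewrite -leqNgt.
Qed.

Lemma add_line_exchange Y v w : v \notin Y -> v \in (Y + <[w]>)%VS ->
  w \in (Y + <[v]>)%VS.
Proof.
move=> vY /memv_add_lineP[k vk]; have k0 : k != 0.
  by apply: contraNneq vY => k0; move: vk; rewrite k0 scale0r subr0.
apply/memv_add_lineP; exists k^-1.
have -> : w - k^-1 *: v = - k^-1 *: (v - k *: w).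
  by rewrite scalerBr scalerA mulNr mulVf // scaleN1r opprK scaleNr addrC.
by rewrite memvZ.
Qed.

(** For z outside [E], an element w of [E] is (w + z) - z, a difference of two vectors outside
    [E]. *)
Lemma subgroup_full_of_complement (A : {pred V}) E :
    (forall v w, v \in A -> w \in A -> v - w \in A) ->
    (\dim E < \dim {:V})%N -> (forall w, w \notin E -> w \in A) ->
  forall w, w \in A.
Proof.
move=> A_B /proper_exists_notin[z zE] notE_A w.
have [wE|/notE_A//] := boolP (w \in E).
rewrite -[w](addrK z) A_B ?notE_A //.
by rewrite rpredDl.
Qed.

(** Let a be the factor of one v outside E = Y + <e>. The vectors with factor a modulo Y form a
    subgroup A, so it suffices to find enough of them to generate V. *)
Lemma additive_collinear_mod Y e (h : {additive V -> V}) :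
    e \notin Y -> (\dim Y + 2 <= \dim {:V})%N ->
    (has_card 2 K -> (\dim Y + 3 <= \dim {:V})%N) ->
    (forall v, v \notin (Y + <[e]>)%VS -> h v \in (Y + <[v]>)%VS) ->
  exists a, forall v, h v - a *: v \in Y.
Proof.
move=> eY dimY dimY2 hE; pose E := (Y + <[e]>)%VS.
have dimE : (\dim E <= \dim Y + 1)%N := dim_add_line _ _.
have YE y : y \in Y -> y \in E by apply/subvP/addvSl.
have eE : e \in E by apply: (subvP (addvSr _ _)); rewrite memv_line.
have [|v vE] := @proper_exists_notin E; first by lia.
have /memv_add_lineP[a hv] := hE v vE.
exists a; pose A : {pred V} := [pred w | h w - a *: w \in Y].
change (forall w, w \in A).
have A_B u w : u \in A -> w \in A -> u - w \in A.
  rewrite !inE => hu hw; suff -> : h (u - w) - a *: (u - w) =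
      (h u - a *: u) - (h w - a *: w) by rewrite memvB.
  by rewrite raddfB; vector_ring.
have A_N u : u \in A -> - u \in A.
  move=> uA; have := A_B (u - u) u; rewrite subrr sub0r; apply=> //.
  by rewrite -(subrr u) A_B.
have A_D u w : u \in A -> w \in A -> u + w \in A.
  by move=> uA wA; rewrite -[w]opprK A_B ?A_N.
have vA : v \in A by rewrite inE.
have vY : v \notin Y by apply: contra vE; apply: YE.
(* Comparing h at w, v and w + v shows that w has the same factor as v. *)
have near w : w \notin E -> w \notin (Y + <[v]>)%VS -> w + v \notin E -> w \in A.
  move=> wE wYv wvE; have /memv_add_lineP[b hw] := hE w wE.
  have /memv_add_lineP[c hwv] := hE _ wvE.
  have comb : (b - c) *: w - (c - a) *: v \in Y.
    have -> : (b - c) *: w - (c - a) *: v =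
        h (w + v) - c *: (w + v) - (h w - b *: w) - (h v - a *: v).
      by rewrite raddfD; vector_ring.
    by apply: memvB => //; apply: memvB.
  have bc : b = c.
    apply: contraNeq wYv; rewrite -subr_eq0 => bc0.
    apply/memv_add_lineP; exists ((b - c)^-1 * (c - a)).
    have -> : w - ((b - c)^-1 * (c - a)) *: v =
        (b - c)^-1 *: ((b - c) *: w - (c - a) *: v).
      by rewrite scalerBr !scalerA mulVf // scale1r.
    by rewrite memvZ.
  move: comb; rewrite bc subrr scale0r add0r rpredN rpredZeq (negPf vY) orbF.
  by rewrite subr_eq0 inE => /eqP <-; rewrite -bc.
(* If E + <v> is proper, [near] applies to every vector outside it, and these generate V. *)
have [ltEv|leEv] := ltnP (\dim (E + <[v]>)) (\dim {:V}).
  apply: (subgroup_full_of_complement A_B ltEv) => w wEv.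
  have EEv u : u \in E -> u \in (E + <[v]>)%VS by apply/subvP/addvSl.
  have vEv : v \in (E + <[v]>)%VS.
    by apply: (subvP (addvSr _ _)); rewrite memv_line.
  apply: near; first by apply: contra wEv; apply: EEv.
    by apply: contra wEv; apply/subvP/addvS => //; apply: addvSl.
  by apply: contra wEv => /EEv; rewrite rpredDr.
(* Now V = E + <v> has dimension at most dim Y + 2, so [dimY2] rules out a field with two
   elements. *)
move=> w; apply: third_scalar.
  by move=> /dimY2; have := dim_add_line E v; lia.
move=> t t0 tN1.
have generic b c y : b != 0 -> c != 0 -> c != -1 -> y \in Y ->
    c *: v + (b *: e + y) \in A.
  move=> b0 c0 cN1 yY.
  have beyE : b *: e + y \in E by rewrite memvD ?memvZ // YE.
  apply: near.
  - by rewrite rpredDr // rpredZeq (negPf c0).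
  - rewrite rpredDl; last by apply: (subvP (addvSr _ _)); rewrite memvZ ?memv_line.
    rewrite rpredDr; last by apply: (subvP (addvSl _ _)).
    rewrite rpredZeq (negPf b0) /=; apply: contra vE => ?.
    exact: add_line_exchange.
  - rewrite addrAC rpredDr // -{2}[v]scale1r -scalerDl rpredZeq addr_eq0.
    by rewrite (negPf cN1).
(* z - v is a sum of two vectors covered by [generic]: the coefficient -1 of v splits as t and -1 -
   t, both different from 0 and -1, and the coefficient b of e splits into two nonzero scalars. *)
have EA z : z \in E -> z \in A.
  move=> /memv_add_lineP[b zbY]; rewrite -[z](subrK v); apply: (A_D) => //.
  have [b' b'0 b'b] : exists2 b', b' != 0 & b - b' != 0.
    have [->|b0] := eqVneq b 0; first by exists 1; rewrite ?sub0r ?oppr_eq0 ?oner_eq0.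
    exists (- t * b); first by rewrite mulf_neq0 ?oppr_eq0.
    by rewrite mulNr opprK -{1}[b]mul1r -mulrDl mulf_neq0 // addrC addr_eq0.
  have -> : z - v = (t *: v + (b' *: e + 0)) +
      ((- 1 - t) *: v + ((b - b') *: e + (z - b *: e))) by vector_ring.
  apply: A_D; apply: generic; rewrite ?mem0v //.
    by rewrite subr_eq0 eq_sym.
  by rewrite -subr_eq0 addrAC subrr sub0r oppr_eq0.
have vA' c : c *: v \in A.
  have [->|c0] := eqVneq c 0; first by rewrite scale0r EA ?mem0v.
  have [->|cN1] := eqVneq c (-1); first by rewrite scaleN1r A_N.
  rewrite -[c *: v](addrK (1 *: e + 0)); apply: A_B.
    by apply: generic; rewrite ?oner_eq0 ?mem0v.
  by rewrite addr0 scale1r EA.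
have : w \in (E + <[v]>)%VS.
  have /eqP -> : (E + <[v]> == {:V})%VS by rewrite eqEdim subvf.
  by rewrite memvf.
move=> /memv_add_lineP[c wc]; rewrite -[w](subrK (c *: v)).
by apply: A_D => //; apply: EA.
Qed.

(** If W + <e> is proper, take y1 outside it and y2 = y1 + e. Otherwise W is a hyperplane missing e,
    and e + w1, e + w2 work for w1, w2 in W independent modulo Y. *)
Lemma two_directions Y W e :
    e \notin Y -> (Y <= W)%VS -> (\dim W < \dim {:V})%N ->
    (\dim Y + 3 <= \dim {:V})%N ->
  exists y1 y2, [/\ y1 \notin W, y2 \notin W, y1 \notin (Y + <[e]>)%VS,
    y2 \notin (Y + <[e]>)%VS & y2 \notin (Y + <[y1]>)%VS].
Proof.
move=> eY YW dimW dimY.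
have YWe : (Y + <[e]> <= W + <[e]>)%VS by apply: addvS.
have eWe Z : e \in (Z + <[e]>)%VS.
  by apply: (subvP (addvSr _ _)); rewrite memv_line.
have [ltWe|leWe] := ltnP (\dim (W + <[e]>)) (\dim {:V}).
  have [y1 y1We] := proper_exists_notin ltWe; exists y1, (y1 + e).
  have y1Ye : y1 \notin (Y + <[e]>)%VS by apply: contra y1We; apply/subvP.
  have y2We : y1 + e \notin (W + <[e]>)%VS by rewrite rpredDr ?eWe.
  split=> //.
  - by apply: contra y1We; apply/subvP/addvSl.
  - by apply: contra y2We; apply/subvP/addvSl.
  - by rewrite rpredDr ?eWe.
  rewrite rpredDl; last by apply: (subvP (addvSr _ _)); rewrite memv_line.
  by apply: contra y1Ye; apply: add_line_exchange.
have eW : e \notin W.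
  apply: contraL dimW => eW; rewrite -leqNgt (leq_trans leWe) // dimvS //.
  by rewrite subv_add subvv.
have bigW Z : (\dim Z <= \dim Y + 1)%N -> exists2 w, w \in W & w \notin Z.
  move=> dimZ; apply/subvPn; apply/negP => /dimvS WZ.
  by have := dim_add_line W e; lia.
have [|w1 w1W w1Y] := bigW Y; first by rewrite addn1.
have [w2 w2W w2Y] := bigW _ (dim_add_line Y w1).
have notYe w : w \in W -> w \notin Y -> e + w \notin (Y + <[e]>)%VS.
  move=> wW wY; rewrite rpredDl ?eWe //; apply: contra eW => /(add_line_exchange wY).
  by apply/subvP; rewrite subv_add YW.
exists (e + w1), (e + w2); split.
- by rewrite rpredDr.
- by rewrite rpredDr.
- exact: notYe.
- by apply: notYe => //; apply: contra w2Y; apply/subvP/addvSl.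
(* Modulo W the relation reads (1 - k) e = 0, so k = 1, and then w2 - w1 lies in Y. *)
apply/memv_add_lineP => -[k yk].
have k1 : k = 1.
  apply/eqP; rewrite eq_sym -subr_eq0; apply: contraR eW => k1.
  have : (1 - k) *: e \in W.
    have -> : (1 - k) *: e = e + w2 - k *: (e + w1) - w2 + k *: w1 by vector_ring.
    by rewrite memvD ?memvZ // memvB // (subvP YW).
  by rewrite rpredZeq (negPf k1).
case/negP: w2Y; apply/memv_add_lineP; exists 1.
by move: yk; rewrite k1 !scale1r opprD addrACA subrr add0r.
Qed.

End SubspaceFacts.

(** * Rank-one operators, operators with range in a subspace, evaluation maps *)

Section Operators.

Variables (K : fieldType) (U V : vectType K).
Implicit Types (Y Z : {vspace V}) (s : 'Hom(U, V)).

Local Notation X := (vbasis {:U}).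

Definition lfun_eval (u : U) (s : 'Hom(U, V)) : V := s u.

Fact lfun_eval_is_linear u : linear (lfun_eval u).
Proof. by move=> a s t; rewrite /lfun_eval add_lfunE scale_lfunE. Qed.

HB.instance Definition _ u :=
  GRing.isLinear.Build K 'Hom(U, V) V _ (lfun_eval u) (lfun_eval_is_linear u).

Definition rank_one_fun (i : 'I_(\dim {:U})) (v : V) (u : U) : V :=
  coord X i u *: v.

Fact rank_one_fun_is_linear i v : linear (rank_one_fun i v).
Proof.
by move=> a u w; rewrite /rank_one_fun linearP scalerDl scalerA.
Qed.

HB.instance Definition _ i v :=
  GRing.isLinear.Build K U V _ (rank_one_fun i v) (rank_one_fun_is_linear i v).

Definition rank_one i v : 'Hom(U, V) := linfun (rank_one_fun i v).

Lemma rank_oneE i v u : rank_one i v u = coord X i u *: v.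
Proof. exact: lfunE. Qed.

Fact rank_one_is_linear i : linear (rank_one i).
Proof.
move=> a v w; apply/lfunP => u; rewrite add_lfunE scale_lfunE !rank_oneE.
by rewrite scalerDr !scalerA mulrC.
Qed.

HB.instance Definition _ i :=
  GRing.isLinear.Build K V 'Hom(U, V) _ (rank_one i) (rank_one_is_linear i).

Lemma sum_coordE u : u = \sum_i coord X i u *: X`_i.
Proof. by apply: coord_vbasis; rewrite memvf. Qed.

Lemma lfun_sum_rank_one s : s = \sum_i rank_one i (s X`_i).
Proof.
apply/lfunP => u; rewrite sum_lfunE {1}[u]sum_coordE linear_sum.
by apply: eq_bigr => i _; rewrite linearZ rank_oneE.
Qed.

(** This is L(U, Z); testing on a basis presents it as a finite intersection of subspaces. *)
Definition lfuns_into Z : {vspace 'Hom(U, V)} :=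
  (\bigcap_(i < \dim {:U}) (linfun (lfun_eval X`_i) @^-1: Z))%VS.

Lemma lfuns_intoP Z s : reflect (forall u, s u \in Z) (s \in lfuns_into Z).
Proof.
have eval_in u : (s u \in Z) = (s \in linfun (lfun_eval u) @^-1: Z)%VS.
  by rewrite -memv_preim lfunE.
apply: (iffP idP) => [|sZ].
  move=> /subv_bigcapP sZ u; rewrite [u]sum_coordE linear_sum memv_suml // => i _.
  by rewrite linearZ memvZ // eval_in; apply: sZ.
by apply/subv_bigcapP => i _; have := sZ X`_i; rewrite eval_in.
Qed.

Lemma limg_lfuns_into Z s : s \in lfuns_into Z -> (limg s <= Z)%VS.
Proof. by move=> /lfuns_intoP sZ; apply/subvP => _ /memv_imgP[u _ ->]. Qed.

Lemma lfuns_intoS Y Z : (Y <= Z)%VS -> (lfuns_into Y <= lfuns_into Z)%VS.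
Proof.
by move=> /subvP YZ; apply/subvP => s /lfuns_intoP sY; apply/lfuns_intoP => u; apply: YZ.
Qed.

Lemma rank_one_lfuns_into i v Z : v \in Z -> rank_one i v \in lfuns_into Z.
Proof. by move=> vZ; apply/lfuns_intoP => u; rewrite rank_oneE memvZ. Qed.

Lemma lfun_eval_surj u v : u != 0 -> exists s : 'Hom(U, V), s u = v.
Proof.
move=> u0; have [i ci] : exists i, coord X i u != 0.
  apply/existsP; apply: contraNT u0 => /existsPn c0.
  rewrite [u]sum_coordE big1 // => i _.
  by have /negPn/eqP -> := c0 i; rewrite scale0r.
by exists ((coord X i u)^-1 *: rank_one i v); rewrite scale_lfunE rank_oneE scalerK.
Qed.

(** Evaluation at a nonzero u is onto V, so taking preimages preserves codimension. *)
Lemma dim_lfun_eval_preim u Z : u != 0 ->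
  (\dim (linfun (lfun_eval u) @^-1: Z) + \dim {:V} =
   \dim {:'Hom(U, V)} + \dim Z)%N.
Proof.
move=> u0; set ev := linfun (lfun_eval u).
have ev_full : limg ev = fullv.
  apply/eqP; rewrite eqEsubv subvf; apply/subvP => v _.
  have [s <-] := lfun_eval_surj v u0.
  by apply/memv_imgP; exists s; rewrite ?memvf ?lfunE.
have := limg_ker_dim ev (ev @^-1: Z); rewrite lpreimK ?ev_full ?subvf //.
have /capv_idPr -> : (lker ev <= ev @^-1: Z)%VS by rewrite -lpreim0 lpreimS ?sub0v.
have := limg_ker_dim ev fullv; rewrite ev_full capfv => dim_ker <-.
by rewrite -dim_ker addnAC.
Qed.

(** * Locality modulo a subspace *)

Section ModuloSubspace.

Variables (S : {vspace 'Hom(U, V)}) (F : {additive 'Hom(U, V) -> V}) (e : V).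
Hypothesis F_range : forall s, s \in S -> e \notin limg s -> F s \in limg s.

Local Notation M Y := (S + lfuns_into Y)%VS.

Lemma range_mod Y s : e \notin Y -> s \in S -> s \in lfuns_into Y -> F s \in Y.
Proof.
move=> eY sS /limg_lfuns_into/subvP sY; apply: (sY); apply: F_range => //.
by apply: contra eY; apply: sY.
Qed.

Lemma local_mod_full Y : e \notin Y -> M Y = fullv ->
    (\dim Y + 2 <= \dim {:V})%N ->
    (has_card 2 K -> (\dim Y + 3 <= \dim {:V})%N) ->
  exists x, forall s, s \in S -> F s - s x \in Y.
Proof.
move=> eY MY dimY dimY2; pose L := lfuns_into Y.
have splitL s : addv_pi1 S L s + addv_pi2 S L s = s.
  by apply: addv_pi1_pi2; rewrite MY memvf.
have col i : exists a, forall v,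
    F (addv_pi1 S L (rank_one i v)) - a *: v \in Y.
  pose h : {additive V -> V} := F \o addv_pi1 S L \o rank_one i.
  (* The S-component of [rank_one i v] differs from it by an operator into Y, so it maps into Y +
     <v>, which misses e by exchange. *)
  apply: (additive_collinear_mod (h := h) eY) => // v vYe /=.
  apply: range_mod; rewrite ?memv_pi1 //.
    by apply: contra vYe; apply: add_line_exchange.
  have -> : addv_pi1 S L (rank_one i v) = rank_one i v - addv_pi2 S L (rank_one i v).
    by rewrite -{2}[rank_one i v]splitL addrK.
  apply: memvB.
    by apply: rank_one_lfuns_into; apply: (subvP (addvSr _ _)); rewrite memv_line.
  by apply: (subvP (lfuns_intoS (addvSl _ _))); apply: memv_pi2.
have [a ha] := fin_all_exists col.
exists (\sum_i a i *: X`_i) => s sS.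
(* As s is in S, its component in L is also in S, so [range_mod] applies to it. *)
have F2 : F (addv_pi2 S L s) \in Y.
  apply: range_mod; rewrite ?memv_pi2 //.
  have -> : addv_pi2 S L s = s - addv_pi1 S L s by rewrite -{2}[s]splitL addrC addKr.
  by rewrite memvB ?memv_pi1.
rewrite -{1}[s]splitL raddfD addrAC memvD //.
have -> : s (\sum_i a i *: X`_i) = \sum_i a i *: s X`_i.
  by rewrite linear_sum; apply: eq_bigr => i _; rewrite linearZ.
rewrite {1}[s]lfun_sum_rank_one linear_sum raddf_sum -sumrB memv_suml // => i _.
exact: ha.
Qed.

(** The bounds say codim (M Y) <= dim (V / Y) - 2, or - 3 over two elements. They survive adding a
    line to Y: the right side drops by at most one, and the left by at least one if [M Y] grows. *)
Lemma local_mod Y : e \notin Y ->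
    (\dim {:'Hom(U, V)} + \dim Y + 2 <= \dim {:V} + \dim (M Y))%N ->
    (has_card 2 K ->
      (\dim {:'Hom(U, V)} + \dim Y + 3 <= \dim {:V} + \dim (M Y))%N) ->
  exists x, forall s, s \in S -> F s - s x \in Y.
Proof.
have [n] := ubnP (\dim {:'Hom(U, V)} - \dim (M Y)).
elim: n Y => // n IHn Y codimM eY dimM dimM2.
have [leM|ltM] := leqP (\dim {:'Hom(U, V)}) (\dim (M Y)).
  have MY : M Y = fullv by apply/eqP; rewrite eqEdim subvf.
  rewrite MY in dimM dimM2.
  by apply: local_mod_full => // [|/dimM2]; lia.
(* W is the set of y such that M Y contains every operator with range in <[y]>;
   adding any other y to Y decreases the codimension of M Y. *)
pose W := (\bigcap_(i < \dim {:U}) (linfun (rank_one i) @^-1: M Y))%VS.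
have WP y : reflect (forall i, rank_one i y \in M Y) (y \in W).
  have preim i : (rank_one i y \in M Y) =
      (<[y]> <= linfun (rank_one i) @^-1: M Y)%VS.
    by rewrite -memvE -memv_preim lfunE.
  by apply: (iffP subv_bigcapP) => yM i => [|_]; rewrite ?preim; [exact: yM|rewrite -preim].
have YW : (Y <= W)%VS.
  apply/subvP => y yY; apply/WP => i; apply: (subvP (addvSr _ _)).
  exact: rank_one_lfuns_into.
have dimW : (\dim W < \dim {:V})%N.
  rewrite ltnNge; apply: contraL ltM => leW; rewrite -leqNgt.
  have Wfull : W = fullv by apply/eqP; rewrite eqEdim subvf.
  apply/dimvS/subvP => s _; rewrite [s]lfun_sum_rank_one memv_suml // => i _.
  by apply/WP; rewrite Wfull memvf.
have [|y1 [y2 [y1W y2W y1e y2e y12]]] := two_directions eY YW dimW; first by lia.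
have step y : y \notin W -> y \notin (Y + <[e]>)%VS ->
    exists x, forall s, s \in S -> F s - s x \in (Y + <[y]>)%VS.
  move=> yW ye; have dimYy := dim_add_line Y y.
  (* Without growth, [M Y] would contain all operators with range in <y>, putting y in W. *)
  have ltMM : (\dim (M Y) < \dim (M (Y + <[y]>)))%N.
    have sMM : (M Y <= M (Y + <[y]>))%VS.
      by apply: addvS => //; apply: lfuns_intoS; apply: addvSl.
    rewrite ltnNge; apply: contra yW => leMM.
    have /eqP MM : (M Y == M (Y + <[y]>))%VS by rewrite eqEdim sMM.
    apply/WP => i; rewrite MM; apply: (subvP (addvSr _ _)).
    by apply: rank_one_lfuns_into; apply: (subvP (addvSr _ _)); rewrite memv_line.
  apply: IHn; try lia.
    by apply: contra ye; apply: add_line_exchange.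
  by move=> /dimM2; lia.
have [x1 F1] := step y1 y1W y1e; have [x2 F2] := step y2 y2W y2e.
pose P := (Y + <[y1]> + <[y2]>)%VS.
have sP s : s \in S -> s (x1 - x2) \in P.
  move=> sS; have -> : s (x1 - x2) = (F s - s x2) - (F s - s x1).
    by rewrite linearB; vector_ring.
  apply: memvB.
    by apply: (subvP _ _ (F2 s sS)); apply: addvS => //; apply: addvSl.
  by apply: (subvP _ _ (F1 s sS)); apply: addvSl.
(* If x1 <> x2, the codimension bound forces M Y = T, hence y1 \in W. *)
have [x12|x12] := eqVneq (x1 - x2) 0; last first.
  pose T := (linfun (lfun_eval (x1 - x2)) @^-1: P)%VS.
  have MT : (M Y <= T)%VS.
    rewrite subv_add; apply/andP; split; apply/subvP => s.
      by move=> /sP; rewrite -memv_preim lfunE.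
    move=> /lfuns_intoP sY; rewrite -memv_preim lfunE.
    by apply: (subvP _ _ (sY _)); rewrite /P -addvA addvSl.
  (* T has dimension dim L(U, V) + dim P - dim V, and dim P <= dim Y + 2, so [dimM] gives dim T <=
     dim (M Y). *)
  have /eqP MTe : (M Y == T)%VS.
    rewrite eqEdim MT; have := dim_lfun_eval_preim P x12.
    have := dim_add_line Y y1; have := dim_add_line (Y + <[y1]>) y2.
    by rewrite -/T -/P /=; move: dimM; rewrite /reverse_coercion; lia.
  case/negP: y1W; apply/WP => i; rewrite MTe -memv_preim lfunE.
  rewrite /= /lfun_eval rank_oneE memvZ //; apply: (subvP (addvSl _ _)).
  by apply: (subvP (addvSr _ _)); rewrite memv_line.
have x1x2 : x1 = x2 by apply/eqP; rewrite -subr_eq0 x12.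
(* A vector of both Y + <y1> and Y + <y2> outside Y could be exchanged with y2, putting y2 in Y +
   <y1>. *)
exists x1 => s sS; apply: contraR y12 => FY.
have /(add_line_exchange FY) y2F : F s - s x1 \in (Y + <[y2]>)%VS.
  by rewrite x1x2; apply: F2.
by apply: (subvP _ _ y2F); rewrite subv_add addvSl; apply: F1.
Qed.

End ModuloSubspace.

End Operators.

(* The bounds are written additively: \dim {:V} - 2 would be truncated at 0. *)
Theorem theorem4p1 (K : fieldType) (U V : vectType K)
    (S : {vspace 'Hom(U, V)})
    (hcodim : (codim S + 2 <= \dim {:V})%N)
    (hcodim2 : has_card 2 K -> (codim S + 3 <= \dim {:V})%N)
    (F : {additive subvs_of S -> V})
    (hF : quasi_range_compatible F) :
  local F.
Proof.
have [D dimD FD] := hF.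
pose e := vpick D; have e0 : e != 0 by rewrite vpick0 -dimv_eq0 dimD.
have eD : (<[e]> <= D)%VS by rewrite -memvE memv_pick.
have /eqP De : (<[e]> == D)%VS by rewrite eqEdim eD dimD dim_vline e0.
(* Projecting onto S extends F to an additive map on all operators, as [local_mod] expects; it is
   then applied with Y = 0. *)
pose F0 : {additive 'Hom(U, V) -> V} := F \o vsproj S.
have F0_range s : s \in S -> e \notin limg s -> F0 s \in limg s.
  move=> sS es; rewrite /= -{2}(vsprojK sS); apply: FD.
  by rewrite vsprojK // -De -memvE.
have dimS : (\dim S <= \dim {:'Hom(U, V)})%N by rewrite dimvS ?subvf.
have dimM : (\dim S <= \dim (S + lfuns_into U (0 : {vspace V})))%N.
  by rewrite dimvS ?addvSl.
have [|||x Fx] := @local_mod K U V S F0 e F0_range 0%VS.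
- by rewrite memv0.
- by move: hcodim; rewrite /codim dimv0; lia.
- by move=> /hcodim2; rewrite /codim dimv0; lia.
exists x => s; have := Fx _ (subvsP s).
by rewrite memv0 subr_eq0 /= vsvalK => /eqP.
Qed.
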